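(* Let $\boldsymbol{u}\in\{0,1\}^{\mathbb N}\setminus\{0^\infty,1^\infty\}$ be neither a characteristic Sturmian sequence nor a characteristic periodic balanced sequence. Let $v$ be the longest central prefix of $\boldsymbol{u}$. Then $v$ is finite and nonempty, and: (i) If $v=1^k$ for some $k\ge1$, then $\phi(0\boldsymbol{u})=(1^k0)^\infty=(1w_{p,q}0)^\infty$ with $p=k$, $q=k+1$. (ii) If $v=0^k$ for some $k\ge1$, then $\phi(0\boldsymbol{u})=(10^k)^\infty=(1w_{p,q}0)^\infty$ with $p=1$, $q=k+1$. (iii) Suppose $v$ contains both $0$'s and $1$'s, and let $v_1,v_2$ be the unique pair of central words with $v=v_101v_2=v_210v_1$; put $\ell_1=|v_1|+2$, $\ell_2=|v_2|+2$ (coprime periods of $v$). Write the prefix of length $2|v|+4$ of $\boldsymbol{u}$ as $vxyz$ with $x,y\in\{0,1\}$ and $|z|=|v|+2$. (a) If either $xy=01$ and $z>v01$, or $xy=10$ and $z<v10$, then $\phi(0\boldsymbol{u})=(1v0)^\infty=(1w_{p,q}0)^\infty$ with $p=|v|_1+1$ and $q=|v|+2=\ell_1+\ell_2$. (b) If either $xy=01$ and $z<v01$, or $xy=00$, then $\phi(0\boldsymbol{u})=(1v_20)^\infty=(1w_{p,q}0)^\infty$ with $p=|v_2|_1+1$, $q=\ell_2$. (c) If either $xy=10$ and $z>v10$, or $xy=11$, then $\phi(0\boldsymbol{u})=(1v_10)^\infty=(1w_{p,q}0)^\infty$ with $p=|v_1|_1+1$, $q=\ell_1$.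
   Context: $\le,<$ denote the lexicographic order (on sequences, and on words of equal length) with $0<1$; $T$ is the shift map; $v^\infty=vvv\cdots$; $|w|$ is the length and $|w|_1$ the number of $1$'s in a word $w$. $\phi(\boldsymbol{x}):=\inf\{\boldsymbol{y}\in\{0,1\}^{\mathbb N}:\exists\boldsymbol{s}\in\{0,1\}^{\mathbb N},\ \boldsymbol{x}\le T^k(\boldsymbol{s})\le\boldsymbol{y}\ \forall k\ge0\}$. A characteristic Sturmian sequence is $(\lfloor(n+2)\alpha\rfloor-\lfloor(n+1)\alpha\rfloor)_{n\ge0}$ with $\alpha\in(0,1)$ irrational. For coprime integers $0<p<q$, $w_{p,q}$ is the unique word of length $q-2$ with $(\lfloor(n+1)p/q\rfloor-\lfloor np/q\rfloor)_{n\ge0}=(0w_{p,q}1)^\infty$; the central words are exactly the words $w_{p,q}$; the characteristic periodic balanced sequences of slope $p/q$ are $(w_{p,q}10)^\infty$ and $(w_{p,q}01)^\infty$. A central prefix of $\boldsymbol{u}$ is a prefix of $\boldsymbol{u}$ that is a central word. Every central word not in $0^*\cup1^*$ can be written uniquely as $v=v_101v_2=v_210v_1$ with $v_1,v_2$ central, and then $|v_1|+2,|v_2|+2$ are coprime periods of $v$. *)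

(* Defs.v *)
From HB Require Import structures.
From mathcomp Require Import all_boot all_order all_algebra.
From mathcomp Require Import mathcomp_extra boolp classical_sets functions.
From mathcomp Require Import classical_orders reals.

Set Implicit Arguments.
Unset Strict Implicit.
Unset Printing Implicit Defensive.
Import Order.TTheory.

Local Open Scope classical_set_scope.

(* The letters 0 and 1 are false and true, so that false < true. *)
Definition word := seq bool.

(* {0,1}^N, ordered lexicographically by the canonical order instance of
   big_lexi_order. *)
Notation binseq := (big_lexi_order (fun _ : nat => bool)).

Definition word_lt (s t : word) : bool := ((s : seqlexi bool) < t)%O.

Definition shift (k : nat) (s : binseq) : binseq := fun n => s (k + n).

Definition scons (b : bool) (s : binseq) : binseq :=
  fun n => if n is m.+1 then s m else b.

(* v^oo; only meaningful for nonempty v. *)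
Definition omega (v : word) : binseq := fun n => nth false v (n %% size v).

(* The default value is irrelevant: see phi_infimums. *)
Definition phi (x : binseq) : binseq :=
  infimum ((fun=> false) : binseq)
    [set y : binseq | exists s : binseq,
       forall k, (x <= shift k s)%O /\ (shift k s <= y)%O].

Definition slope (p q : nat) : bool := [&& 0 < p, p < q & coprime p q].

(* For p < q the difference floor((n+1)p/q) - floor(np/q) is 0 or 1; it is
   encoded as a boolean, see mech_wordE. *)
Definition mech_word (p q : nat) : binseq :=
  fun n => (n.+1 * p) %/ q != (n * p) %/ q.

(* The word w_{p,q}; its defining property is central_wordP. *)
Definition central_word (p q : nat) : word :=
  mkseq (fun n => mech_word p q n.+1) (q - 2).

Definition central (v : word) : Prop :=
  exists p q, slope p q /\ v = central_word p q.

Definition characteristic_sturmian (R : realType) (u : binseq) : Prop :=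
  exists alpha : R, [/\ (0 < alpha)%R, (alpha < 1)%R, irrational alpha &
    forall n : nat, (Posz (nat_of_bool (u n)) =
      Num.floor (n.+2%:R * alpha) - Num.floor (n.+1%:R * alpha))%R].

Definition characteristic_periodic_balanced (u : binseq) : Prop :=
  exists p q, slope p q /\
    (u = omega (central_word p q ++ [:: true; false]) \/
     u = omega (central_word p q ++ [:: false; true])).

Definition central_prefix (u : binseq) (v : word) : Prop :=
  central v /\ v = mkseq u (size v).

Definition longest_central_prefix (u : binseq) (v : word) : Prop :=
  central_prefix u v /\ forall v', central_prefix u v' -> size v' <= size v.

Definition central_decomposition (v v1 v2 : word) : Prop :=
  [/\ central v1, central v2,
      v = v1 ++ [:: false; true] ++ v2 & v = v2 ++ [:: true; false] ++ v1].

Definition is_period (l : nat) (v : word) : Prop :=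
  0 < l <= size v /\
  forall i, i + l < size v -> nth false v (i + l) = nth false v i.

Lemma mech_wordE p q n : p < q ->
  nat_of_bool (mech_word p q n) = (n.+1 * p) %/ q - (n * p) %/ q.
Proof.
move=> pq; rewrite /mech_word.
have q0 : 0 < q by apply: leq_ltn_trans pq.
have le1 : (n * p) %/ q <= (n.+1 * p) %/ q by rewrite leq_div2r// mulSn leq_addl.
have le2 : (n.+1 * p) %/ q <= ((n * p) %/ q).+1.
  have -> : ((n * p) %/ q).+1 = (n * p + q) %/ q by rewrite divnDr// divnn q0 addn1.
  by rewrite leq_div2r// mulSn addnC leq_add2l ltnW.
move: le1; rewrite leq_eqVlt => /predU1P[->|lt]; first by rewrite eqxx subnn.
have -> : (n.+1 * p) %/ q = ((n * p) %/ q).+1 by apply/eqP; rewrite eqn_leq le2.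
by rewrite gtn_eqF// subSnn.
Qed.

Lemma mech_word_modn p q n : 0 < q -> mech_word p q (n %% q) = mech_word p q n.
Proof.
move=> q0; rewrite /mech_word.
have key m : (n %/ q * q + m) * p %/ q = n %/ q * p + m * p %/ q.
  by rewrite mulnDl mulnAC divnDl ?dvdn_mull// mulnK.
by rewrite [in RHS](divn_eq n q) -addnS !key eqn_add2l.
Qed.

Lemma central_wordP p q (w : word) : slope p q ->
  (size w = q - 2 /\ mech_word p q = omega (false :: w ++ [:: true])) <->
  w = central_word p q.
Proof.
case/and3P=> p0 pq _; case: q pq => [|[|q]]; first by [].
  by rewrite ltnS leqn0 => /eqP p00; rewrite p00 in p0.
move=> pq; rewrite /central_word subSS subSS subn0; split=> [[sw E]|->].
  apply: (@eq_from_nth _ false) => [|i]; rewrite ?size_mkseq ?sw// => iq.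
  rewrite nth_mkseq// E /omega /= size_cat sw addn1 modn_small ?ltnS 1?ltnW//=.
  by rewrite nth_cat sw iq.
split; first by rewrite size_mkseq.
apply/funext => n; rewrite /omega /= size_cat size_mkseq addn1 -mech_word_modn//.
have := ltn_pmod n (ltn0Sn q.+1); case: (n %% q.+2) => [_|m] /=.
  by rewrite /mech_word mul1n mul0n div0n divn_small.
rewrite ltnS nth_cat size_mkseq => mq; case: ltnP => [lt|le].
  by rewrite nth_mkseq.
have -> : m = q by apply/eqP; rewrite eqn_leq le -ltnS mq.
rewrite subnn /= /mech_word mulKn// gtn_eqF// ltn_divLR// mulnC.
by rewrite ltn_pmul2l.
Qed.

Lemma lexP (x y : binseq) : reflect
  (x = y \/ exists n, [/\ forall i, i < n -> x i = y i, x n = false & y n = true])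
  (x <= y)%O.
Proof.
rewrite leEbig_lexi_order; case E : (first_diff x y) => [n|].
  move/first_diff_SomeP: E => [pre /eqP ne]; apply: (iffP idP) => [le|].
    right; exists n; split=> //; by move: le ne; case: (x n); case: (y n).
  case=> [xy|[m [pm xm ym]]]; first by rewrite xy in ne.
  case: (ltngtP n m) => [nm|mn|->]; last by rewrite xm ym.
    by rewrite pm in ne.
  by have := pre m mn; rewrite xm ym.
by apply: (iffP idP) => // _; left; apply/first_diff_NoneP.
Qed.

Lemma lex_infimums (A : set binseq) : infimums A !=set0.
Proof.
(* greedy choice of the letters of the infimum, prefix by prefix *)
pose bit (s : word) := ~~ `[< exists2 y : binseq, A y &
  mkseq y (size s).+1 = rcons s false >].
pose pre := fix pre n : word := if n is m.+1 then rcons (pre m) (bit (pre m)) else [::].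
pose m : binseq := fun n => bit (pre n).
have preE n : pre n = mkseq m n.
  by elim: n => // n IH; rewrite mkseqS -IH.
have mP n : m n = false <-> exists2 y : binseq, A y &
    (forall i, i < n -> y i = m i) /\ y n = false.
  rewrite /m /bit; split=> [/negbFE/asboolP[y Ay]|[y Ay [yi yn]]].
    rewrite preE size_mkseq mkseqS => /rcons_inj[e yn]; exists y => //; split=> // i lt.
    by have := congr1 (fun s => nth false s i) e; rewrite !nth_mkseq.
  apply/negbTE; rewrite negbK; apply/asboolP; exists y => //.
  rewrite preE size_mkseq mkseqS yn; congr rcons.
  apply: (@eq_from_nth _ false); rewrite ?size_mkseq// => i lt.
  by rewrite !nth_mkseq// yi.
exists m; split=> [y Ay|b bA].
  rewrite leNgt; apply/negP; rewrite lt_neqAle => /andP[/eqP ne /lexP[/ne//|[n [yi yn mn]]]].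
  by have [_] := mP n; rewrite mn => H; suff : true = false by []; apply: H; exists y.
rewrite leNgt; apply/negP; rewrite lt_neqAle => /andP[/eqP ne /lexP[/ne//|[n [mi mn bn]]]].
have [y Ay [yi yn]] := (mP n).1 mn.
have /lexP[by_|[k [bk bkf ykt]]] := bA y Ay.
  by move: bn; rewrite by_ yn.
case: (ltngtP k n) => [kn|nk|kn].
- by move: bkf; rewrite -mi// -yi// ykt.
- by move: bn; rewrite bk// yn.
- by move: bn; rewrite -kn bkf.
Qed.

Lemma phi_infimums (x : binseq) :
  infimums [set y : binseq | exists s : binseq,
    forall k, (x <= shift k s)%O /\ (shift k s <= y)%O] (phi x).
Proof.
rewrite /phi /infimum; set A := [set y | _].
case: ifPn => [/eqP A0|_]; last first.
  by case: xgetP => // H; have [y /H] := lex_infimums A.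
have top (z : binseq) : (z <= ((fun=> true) : binseq))%O.
  by rewrite leEbig_lexi_order; case: first_diff => // n; case: (z n).
suff : A ((fun=> true) : binseq) by rewrite A0.
by exists (fun=> true) => k; split; exact: top.
Qed.

(* Main.v *)
Require Import Defs.
From HB Require Import structures.
From mathcomp Require Import all_boot all_order all_algebra.
From mathcomp Require Import boolp classical_sets classical_orders reals.
From mathcomp Require Import zify.

(* Write w = w_{p,q}. The core fact is that phi(0u) = (1w0)^oo for all u between
   (w01)^oo and (w10)^oo. The orbit of (0w1)^oo stays in [(0w1)^oo, (1w0)^oo], because
   floor(np/q), floor((k+n)p/q) - floor(kp/q) and ceil(np/q) count the 1's in the prefixes
   of length n and are ordered in this way; this gives the upper bound. Conversely, if
   all shifts of s are at least 0(w01)^oo, then the first n letters of s contain at least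
   np/q - 1 letters 1, while if all shifts were smaller than (1w0)^oo, s would be a
   concatenation of blocks with density of 1's less than p/q, with unbounded total deficit.

   A decomposition v = v1 01 v2 = v2 10 v1 corresponds to a Farey mediant
   (p1 + p2)/(q1 + q2) with p1 q2 - p2 q1 = 1. Hence v 01 v2 = v2 10 v and
   v 10 v1 = v1 01 v are central too and prefixes of (v2 10)^oo and (v1 01)^oo; since v is
   the longest central prefix, u leaves v 01 v2 or v 10 v1 early enough to be placed in
   the interval of v, v2 or v1.

   If the central prefixes of u are unbounded, then the number U(n) of 1's among its first
   n letters is floor((n+1)p/q) for infinitely many slopes p/q, and with
   alpha = sup U(n)/(n+1) it is floor((n+1) alpha) for all n or ceil((n+1) alpha) - 1 for
   all n, so u is constant, characteristic Sturmian or characteristic periodic. *)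

Set Implicit Arguments.
Unset Strict Implicit.
Unset Printing Implicit Defensive.
Import Order.TTheory.

Lemma divn_uniq (m d k : nat) : k * d <= m < k.+1 * d -> m %/ d = k.
Proof.
case/andP=> le lt; apply/eqP; rewrite eqn_leq -ltnS.
have d0 : 0 < d by case: d le lt => // _; rewrite muln0.
by rewrite ltn_divLR// lt leq_divRL.
Qed.

Lemma divn_bounds (m d : nat) : 0 < d -> m %/ d * d <= m < (m %/ d).+1 * d.
Proof. by move=> d0; rewrite leq_divM ltn_ceil. Qed.

(** * Counting ones in prefixes *)

Definition ones (x : binseq) (n : nat) : nat := count_mem true (mkseq x n).

Lemma ones0 x : ones x 0 = 0. Proof. by []. Qed.

Lemma onesS x n : ones x n.+1 = ones x n + x n.
Proof. by rewrite /ones mkseqS -cats1 count_cat /= addn0; case: (x n). Qed.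

Lemma eq_in_ones x y n : (forall i, i < n -> x i = y i) -> ones x n = ones y n.
Proof.
move=> E; rewrite /ones; congr (count_mem _ _).
by apply/eq_in_map => i; rewrite mem_iota => /andP[_ lt]; exact: E.
Qed.

Lemma ones_inj x y : ones x =1 ones y -> x = y.
Proof.
move=> E; apply/funext => n; have := E n.+1.
by rewrite !onesS E => /addnI; case: (x n); case: (y n).
Qed.

Lemma onesD x k n : ones x (k + n) = ones x k + ones (shift k x) n.
Proof. by elim: n => [|n IH]; rewrite ?addn0// addnS !onesS IH addnA. Qed.

Lemma ones_shift k x n : ones (shift k x) n = ones x (k + n) - ones x k.
Proof. by rewrite onesD addKn. Qed.

Lemma ones_scons b x n : ones (scons b x) n.+1 = b + ones x n.
Proof. by elim: n => [|n IH]; rewrite onesS ?addn0// IH onesS addnA. Qed.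

(** Before the first difference the counts agree, and at it the larger sequence gains a 1. This
    turns lexicographic comparisons into comparisons of floors. *)
Lemma ones_le_lex (x y : binseq) : (forall n, ones x n <= ones y n) -> (x <= y)%O.
Proof.
move=> le; rewrite leNgt; apply/negP; rewrite lt_neqAle => /andP[/eqP ne].
move=> /lexP[/ne//|[n [E yn xn]]]; have := le n.+1.
by rewrite !onesS (eq_in_ones E) yn xn; lia.
Qed.

Lemma ones_lex (x y : binseq) : (x <= y)%O ->
  x = y \/ exists n, [/\ ones x n = ones y n, x n = false & y n = true].
Proof.
move=> /lexP[->|[n [E xn yn]]]; [by left|right; exists n; split=> //].
exact: eq_in_ones.
Qed.

Lemma scons_le (b : bool) (x y : binseq) : (x <= y)%O -> (scons b x <= scons b y)%O.
Proof.
move=> /lexP[->//|[n [E xn yn]]]; apply/lexP; right; exists n.+1.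
by split=> // -[//|i]; exact: E.
Qed.

Lemma shift1_scons b x : shift 1 (scons b x) = x.
Proof. by apply/funext. Qed.

Lemma scons_shift1 x : scons (x 0) (shift 1 x) = x.
Proof. by apply/funext => -[]. Qed.

Lemma shift_shift k l x : shift k (shift l x) = shift (l + k) x.
Proof. by apply/funext => n; rewrite /shift addnA. Qed.

Lemma shift_omega v : shift (size v) (omega v) = omega v.
Proof. by apply/funext => n; rewrite /shift /omega modnDl. Qed.

Lemma shift1_omega a w : shift 1 (omega (a :: w)) = omega (rcons w a).
Proof.
apply/funext => n; rewrite /shift /omega size_rcons /= add1n.
have := divn_eq n (size w).+1; set r := n %% _ => En.
have lr : r < (size w).+1 by rewrite ltn_pmod.
rewrite -addn1 -modnDml -/r addn1 nth_rcons.
move: lr; rewrite ltnS leq_eqVlt => /predU1P[->|lr].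
  by rewrite modnn ltnn eqxx.
by rewrite modn_small ?ltnS// lr.
Qed.

(** * Mechanical sequences *)

(** The letters are ceil((n+1)p/q) - ceil(np/q), with ceil(m/q) written as floor((m+q-1)/q); for a
    slope this is (1w0)^oo, see [omega_upper_mech]. *)
Definition upper_mech (p q : nat) : binseq :=
  fun n => (n.+1 * p + q.-1) %/ q != (n * p + q.-1) %/ q.

Lemma ones_mech p q n : p < q -> ones (mech_word p q) n = n * p %/ q.
Proof.
move=> pq; elim: n => [|n IH]; first by rewrite ones0 mul0n div0n.
by rewrite onesS IH mech_wordE// subnKC// leq_div2r// leq_mul2r leqnSn orbT.
Qed.

Lemma ones_upper_mech p q n : 0 < p < q ->
  ones (upper_mech p q) n = (n * p + q.-1) %/ q.
Proof.
move=> /andP[p0 pq]; elim: n => [|n IH].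
  by rewrite ones0 mul0n divn_small//; lia.
rewrite onesS IH /upper_mech.
set b := (n * p + _) %/ q; set a := _ %/ q.
have q0 : 0 < q by lia.
have /andP[a1 a2] : a * q <= n.+1 * p + q.-1 < a.+1 * q by apply: divn_bounds.
have /andP[b1 b2] : b * q <= n * p + q.-1 < b.+1 * q by apply: divn_bounds.
have : b <= a by rewrite leq_div2r// leq_add2r leq_mul2r leqnSn orbT.
have : a <= b.+1.
  rewrite -ltnS -(ltn_pmul2r q0); apply: leq_ltn_trans a1 _.
  by rewrite mulSn; move: b2; rewrite !mulSn; lia.
by case: eqP => /=; lia.
Qed.

Lemma size_central_word p q : size (central_word p q) = q - 2.
Proof. by rewrite size_mkseq. Qed.

Lemma ceil_divn m q : 0 < q -> ~~ (q %| m) -> (m + q.-1) %/ q = (m %/ q).+1.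
Proof.
move=> q0; rewrite /dvdn => nd; apply: divn_uniq.
by have := divn_eq m q; have := ltn_pmod m q0; nia.
Qed.

Lemma slope_ndvd p q j : slope p q -> 0 < j < q -> ~~ (q %| j * p).
Proof.
move=> /and3P[_ _ cpq] /andP[j0 jq]; rewrite Gauss_dvdl 1?coprime_sym//.
by rewrite gtnNdvd.
Qed.

(** For 0 < j < q the number jp/q is not an integer, so its ceiling is its floor plus one and the
    letters inside a period are those of [mech_word]; only the two end letters swap. *)
Lemma omega_upper_mech p q : slope p q ->
  omega (true :: central_word p q ++ [:: false]) = upper_mech p q.
Proof.
move=> sl; have /and3P[p0 pq _] := sl.
have perm n : upper_mech p q (n %% q) = upper_mech p q n.
  rewrite /upper_mech.
  have key m : ((n %/ q * q + m) * p + q.-1) %/ q = n %/ q * p + (m * p + q.-1) %/ q.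
    by rewrite mulnDl -addnA mulnAC divnDl ?dvdn_mull// mulnK//; lia.
  by rewrite [in RHS](divn_eq n q) -addnS !key eqn_add2l.
have sz : (size (central_word p q ++ [:: false])).+1 = q.
  by rewrite size_cat size_central_word /=; lia.
apply/funext => n; rewrite /omega [size (_ :: _)]/= sz -perm.
have := @ltn_pmod n q; case: (n %% q) => [_|m] /=.
  rewrite /upper_mech mul1n mul0n add0n [q.-1 %/ _]divn_small; last by lia.
  by rewrite (@divn_uniq (p + q.-1) _ 1)//; lia.
move=> /(_ ltac:(lia)) mq; rewrite nth_cat size_central_word; case: ltnP => [lt|le].
  by rewrite nth_mkseq// /upper_mech /mech_word !ceil_divn ?(slope_ndvd sl)//; lia.
have -> : m = q - 2 by lia.
rewrite subnn /= /upper_mech; apply/esym/negbTE; rewrite negbK; apply/eqP.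
by rewrite !(@divn_uniq _ q p)//; nia.
Qed.

Lemma omega_mech p q : slope p q ->
  mech_word p q = omega (false :: central_word p q ++ [:: true]).
Proof. by move=> sl; have [] := (central_wordP (central_word p q) sl).2 erefl. Qed.

Lemma omega_10 p q : slope p q ->
  scons false (omega (central_word p q ++ [:: true; false])) = mech_word p q.
Proof.
move=> sl; rewrite -[RHS]scons_shift1 [in shift 1 _]omega_mech// shift1_omega.
rewrite -cats1 -catA; congr scons; have /and3P[p0 pq _] := sl.
by rewrite /mech_word mul1n mul0n div0n divn_small.
Qed.

Lemma omega_01 p q : slope p q ->
  omega (central_word p q ++ [:: false; true]) = shift 1 (upper_mech p q).
Proof. by move=> sl; rewrite -omega_upper_mech// shift1_omega -cats1 -catA. Qed.

(** The sequence is (1w0)^oo with its first letter made 0, so for n > 0 the count is ceil(np/q) - 1;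
    the truncated predecessor also covers n = 0. *)
Lemma ones_omega_01 p q n : slope p q ->
  ones (scons false (omega (central_word p q ++ [:: false; true]))) n =
  (n * p).-1 %/ q.
Proof.
move=> sl; have /and3P[p0 pq _] := sl; case: n => [|n]; first by rewrite mul0n div0n.
rewrite ones_scons omega_01// ones_shift !ones_upper_mech ?p0// add0n add1n mul1n.
rewrite (@divn_uniq (p + q.-1) q 1); last by lia.
apply/eqP; rewrite -(eqn_add2r 1) subnK; last first.
  by rewrite leq_divRL; nia.
have -> : n.+1 * p + q.-1 = (n.+1 * p).-1 + q by nia.
by rewrite divnDr// divnn; lia.
Qed.

(** * The plateaus of phi *)

(* Cut s greedily: comparison with 0(w01)^oo yields blocks of density >= p/q of 1's
   whose prefixes lose at most a bounded amount, comparison with (1w0)^oo yields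
   blocks of density < p/q. *)
Lemma phi_lower p q (s : binseq) : slope p q ->
  let w := central_word p q in
  (forall k, (scons false (omega (w ++ [:: false; true])) <= shift k s)%O) ->
  ~ (forall k, (shift k s < omega (true :: w ++ [:: false]))%O).
Proof.
move=> sl w lo up; have /and3P[p0 pq _] := sl; have q0 : 0 < q by lia.
have lo' k : exists2 n, 0 < n & n * p <= q * ones (shift k s) n /\
    forall m, m <= n -> m * p <= q * ones (shift k s) m + q.
  have /lexP[E|[n [E ln sn]]] := lo k.
    (* If the shift equals 0(w01)^oo, shifting it further by q gives (1w0)^oo itself, which [up]
       forbids. *)
    have := up (k + q); rewrite -shift_shift -E -[q]prednK// -add1n -shift_shift.
    rewrite shift1_scons omega_01// shift_shift add1n prednK//.
    rewrite -omega_upper_mech//.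
    have {1}-> : q = size (true :: w ++ [:: false]).
      by rewrite /= size_cat size_central_word /=; lia.
    by rewrite shift_omega ltxx.
  have onesE m : m <= n -> ones (shift k s) m = (m * p).-1 %/ q.
    move=> le; rewrite -ones_omega_01//; apply: eq_in_ones => i lt.
    by rewrite E//; exact: leq_trans lt le.
  have lem m : m * p <= (m * p).-1 %/ q * q + q.
    by have := @divn_bounds (m * p).-1 q q0; lia.
  (* The 1 of s against a 0 gains one over floor(((n+1)p-1)/q), which lifts the block to density at
     least p/q. *)
  exists n.+1 => //; split=> [|m].
    rewrite onesS sn onesE// -ones_omega_01//.
    have -> : ones (scons false (omega (central_word p q ++ [:: false; true]))) n =
      ones (scons false (omega (central_word p q ++ [:: false; true]))) n.+1.
      by rewrite onesS ln addn0.
    by rewrite ones_omega_01//; have := lem n.+1; lia.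
  rewrite leq_eqVlt => /predU1P[->|lt]; last by rewrite onesE//; have := lem m; lia.
  by rewrite onesS onesE//; have := lem n; rewrite sn; nia.
have up' k : exists2 n, 0 < n & q * ones (shift k s) n < n * p.
  have := up k; rewrite lt_neqAle => /andP[/eqP ne /ones_lex[//|[n [E sn un]]]].
  exists n.+1 => //; rewrite onesS sn E addn0.
  have : ones (omega (true :: w ++ [:: false])) n.+1 =
      (ones (omega (true :: w ++ [:: false])) n).+1 by rewrite onesS un addn1.
  rewrite omega_upper_mech// !ones_upper_mech ?p0// => En.
  by have := @divn_bounds (n.+1 * p + q.-1) q q0; rewrite En; lia.
(* Jump over blocks of [lo'] up to the end of the prefix; only the last, incomplete block can lose,
   and by at most q. *)
have low m k : k * p <= q * ones s k -> (k + m) * p <= q * ones s (k + m) + q.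
  elim/ltn_ind: m k => m IH k good; have [n n0 [gn gm]] := lo' k.
  case: (leqP m n) => [mn|nm].
    by have := gm m mn; rewrite onesD; nia.
  have {IH} := IH (m - n) _ (k + n); rewrite -addnA subnKC; last by lia.
  by apply; [lia|rewrite onesD; nia].
(* Each block of [up'] costs at least one unit, so the deficit outgrows the bound q of [low]. *)
have high j : exists n, j + q * ones s n <= n * p.
  elim: j => [|j [n IH]]; first by exists 0; rewrite ones0 muln0.
  by have [m m0 lt] := up' n; exists (n + m); rewrite onesD; nia.
by have [n] := high q.+1; have := low n 0; rewrite ones0 => /(_ isT); rewrite add0n; lia.
Qed.

Lemma phi_plateau p q (u : binseq) : slope p q ->
  let w := central_word p q in
  (omega (w ++ [:: false; true]) <= u)%O ->
  (u <= omega (w ++ [:: true; false]))%O ->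
  phi (scons false u) = omega (true :: w ++ [:: false]).
Proof.
move=> sl w lo hi; have /and3P[p0 pq _] := sl; have q0 : 0 < q by lia.
have [lb glb] := phi_infimums (scons false u).
apply/le_anti/andP; split.
  (* The witness is (0w1)^oo = 0(w10)^oo, which is at least 0u by [hi]; its shifts are compared with
     both ends through counts of 1's. *)
  apply: lb; exists (mech_word p q) => k; split.
    apply: le_trans (scons_le false hi) _; rewrite omega_10//.
    apply: ones_le_lex => n; rewrite ones_shift !ones_mech// mulnDl.
    rewrite leq_subRL; last by rewrite leq_div2r// leq_addr.
    rewrite -ltnS -(ltn_pmul2r q0).
    have := divn_bounds (k * p + n * p) q0; have := divn_bounds (k * p) q0.
    by have := divn_bounds (n * p) q0; nia.
  rewrite omega_upper_mech//; apply: ones_le_lex => n.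
  rewrite ones_shift !ones_mech ?ones_upper_mech ?p0// leq_subLR mulnDl.
  rewrite -ltnS -(ltn_pmul2r q0).
  have := divn_bounds (k * p + n * p) q0; have := divn_bounds (k * p) q0.
  by have := divn_bounds (n * p + q.-1) q0; nia.
apply: glb => y [s sP]; rewrite leNgt; apply/negP => ylt.
apply: (@phi_lower p q s sl) => k; have [sk1 sk2] := sP k.
  by apply: le_trans sk1; apply: scons_le.
exact: le_lt_trans sk2 ylt.
Qed.

(** * Central words *)

(** The factor n + 1 accounts for the initial 0 that precedes w in [mech_word]. *)
Lemma count_take_central p q n : slope p q -> n <= q - 2 ->
  count_mem true (take n (central_word p q)) = n.+1 * p %/ q.
Proof.
move=> /and3P[p0 pq _] le.
have -> : take n (central_word p q) = mkseq (shift 1 (mech_word p q)) n.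
  by rewrite /central_word /mkseq -map_take take_iota (minn_idPl le).
have := ones_shift 1 (mech_word p q) n; rewrite /ones => ->.
rewrite -!/(ones _ _) !ones_mech// mul1n [p %/ q]divn_small// subn0 add1n.
by [].
Qed.

Lemma divn_slope_pred p q : 0 < p < q -> (q - 1) * p %/ q = p - 1.
Proof. by move=> H; apply: divn_uniq; nia. Qed.

Lemma count_central p q : slope p q -> count_mem true (central_word p q) = p - 1.
Proof.
move=> sl; have := count_take_central sl (leqnn _).
rewrite -{1}(size_central_word p q) take_size => ->.
have /and3P[p0 pq _] := sl; rewrite -(@divn_slope_pred p q) ?p0//; congr (_ * _ %/ _); lia.
Qed.

Lemma central_slope v : central v ->
  slope (count_mem true v + 1) (size v + 2) /\
  v = central_word (count_mem true v + 1) (size v + 2).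
Proof.
move=> [p [q [sl ->]]]; rewrite count_central// size_central_word.
have /and3P[p0 pq _] := sl.
by rewrite !subnK //; lia.
Qed.

(** * Farey mediants and decompositions of central words *)

Lemma slope_addn p1 q1 p2 q2 : 0 < p2 -> p1 < q1 -> p1 * q2 = (p2 * q1).+1 ->
  p2 < q2 -> slope (p1 + p2) (q1 + q2).
Proof.
move=> p20 pq1 D pq2; apply/and3P; split; [lia|lia|].
rewrite /coprime -dvdn1 -(@dvdn_addr (p2 * (q1 + q2))); last first.
  by rewrite dvdn_mull// dvdn_gcdr.
have -> : p2 * (q1 + q2) + 1 = (p1 + p2) * q2 by nia.
by rewrite dvdn_mulr// dvdn_gcdl.
Qed.

(** With p/q the mediant, determinant 1 makes jp/q differ from j p_i/q_i by j/(q q_i), too little to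
    change the floor when 0 < j < q_i. *)
Lemma mediant_divn p1 q1 p2 q2 : slope p1 q1 -> slope p2 q2 ->
  p1 * q2 = (p2 * q1).+1 ->
  let F j := j * (p1 + p2) %/ (q1 + q2) in
  [/\ forall j, 0 < j < q1 -> F j = j * p1 %/ q1,
      forall j, 0 < j < q2 -> F j = j * p2 %/ q2,
      F q1 = p1 - 1, F q2 = p2 &
      (forall j, 0 < j < q2 -> F (q1 + j) = p1 + j * p2 %/ q2) /\
      (forall j, 0 < j < q1 -> F (q2 + j) = p2 + j * p1 %/ q1)].
Proof.
move=> s1 s2 D F; have /and3P[p10 pq1 _] := s1; have /and3P[p20 pq2 _] := s2.
(* The margins exceed what the floor of jp/q needs, since q1 p = p1 q - 1 and q2 p = p2 q + 1:
   shifting j by q1 or q2 moves the residue of jp by one. *)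
have B1 j : 0 < j < q1 -> j * p1 %/ q1 * (q1 + q2) < j * (p1 + p2) /\
    j * (p1 + p2) + 1 < (j * p1 %/ q1).+1 * (q1 + q2).
  move=> Hj; have := divn_eq (j * p1) q1; have := slope_ndvd s1 Hj.
  have : j * p1 %% q1 < q1 by rewrite ltn_mod; lia.
  rewrite /dvdn; set m := _ %/ _; set r := _ %% _ => r1 r0 E.
  have : q1 * (j * (p1 + p2)) + j = m * q1 * (q1 + q2) + r * (q1 + q2) by nia.
  by move=> E'; split; nia.
have B2 j : 0 < j < q2 -> j * p2 %/ q2 * (q1 + q2) < j * (p1 + p2) /\
    j * (p1 + p2) < (j * p2 %/ q2).+1 * (q1 + q2).
  move=> Hj; have := divn_eq (j * p2) q2.
  have : j * p2 %% q2 < q2 by rewrite ltn_mod; lia.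
  set m := _ %/ _; set r := _ %% _ => r1 E.
  have : q2 * (j * (p1 + p2)) = m * q2 * (q1 + q2) + r * (q1 + q2) + j by nia.
  by move=> E'; split; nia.
split; rewrite /F.
- by move=> j /B1[b1 b2]; apply: divn_uniq; lia.
- by move=> j /B2[b1 b2]; apply: divn_uniq; lia.
- by apply: divn_uniq; nia.
- by apply: divn_uniq; nia.
- by split=> j => [/B2|/B1] [b1 b2]; apply: divn_uniq; nia.
Qed.

(** Cuts the word of increments of a counting function F around m: G governs the left part, c + H
    the right part, and two letters at m remain to be evaluated. *)
Lemma mkseq_steps_cat (F G H : nat -> nat) m n c : 1 < m -> 1 < n ->
  (forall j, 0 < j < m -> F j = G j) ->
  (forall j, 0 < j < n -> F (m + j) = c + H j) ->
  mkseq (fun i => F i.+2 != F i.+1) (m + n - 2) =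
  mkseq (fun i => G i.+2 != G i.+1) (m - 2) ++
  [:: F m != F (m - 1); F (m + 1) != F m] ++
  mkseq (fun i => H i.+2 != H i.+1) (n - 2).
Proof.
move=> m1 n1 FG FH; apply: (@eq_from_nth _ false).
  by rewrite !size_cat !size_mkseq /=; lia.
move=> i; rewrite size_mkseq => lt; rewrite nth_mkseq// nth_cat size_mkseq.
case: ltnP => [l1|]; first by rewrite nth_mkseq// !FG//; lia.
rewrite leq_eqVlt => /predU1P[<-|].
  have -> : (m - 2).+2 = m by lia.
  have -> : (m - 2).+1 = m - 1 by lia.
  by rewrite subnn.
rewrite leq_eqVlt => /predU1P[<-|l1].
  have -> : (m - 2).+3 = m + 1 by lia.
  have -> : (m - 2).+2 = m by lia.
  by have -> : (m - 2).+1 - (m - 2) = 1 by lia.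
have [k Ek] : exists k, i = m + k by exists (i - m); lia.
subst i.
have -> : m + k - (m - 2) = k.+2 by lia.
rewrite /= nth_mkseq; last by lia.
by rewrite -!addnS !FH ?eqn_add2l//; lia.
Qed.

(** The floors for the mediant are p1 - 1, p1 - 1, p1 at q1 - 1, q1, q1 + 1, which gives 01 at the
    joint, and p2 - 1, p2, p2 at q2 - 1, q2, q2 + 1, which gives 10. *)
Lemma central_word_mediant p1 q1 p2 q2 : slope p1 q1 -> slope p2 q2 ->
  p1 * q2 = (p2 * q1).+1 ->
  central_word (p1 + p2) (q1 + q2) =
    central_word p1 q1 ++ [:: false; true] ++ central_word p2 q2 /\
  central_word (p1 + p2) (q1 + q2) =
    central_word p2 q2 ++ [:: true; false] ++ central_word p1 q1.
Proof.
move=> s1 s2 D; have [F1 F2 Fq1 Fq2 [G1 G2]] := mediant_divn s1 s2 D.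
have /and3P[p10 pq1 _] := s1; have /and3P[p20 pq2 _] := s2.
have q11 : 1 < q1 by apply: leq_ltn_trans pq1.
have q21 : 1 < q2 by apply: leq_ltn_trans pq2.
have b1 : 0 < q1 - 1 < q1 by clear -q11; lia.
have b2 : 0 < q2 - 1 < q2 by clear -q21; lia.
pose F j := j * (p1 + p2) %/ (q1 + q2).
split.
- have := @mkseq_steps_cat F (fun j => j * p1 %/ q1) (fun j => j * p2 %/ q2) q1 q2 p1
    q11 q21 F1 G1.
  rewrite [F q1]Fq1 [F (q1 - 1)]F1// [F (q1 + 1)]G1 ?q21// divn_slope_pred ?p10//.
  by rewrite mul1n divn_small// eqxx addn0 [X in [:: _; X]]neq_ltn subn1 ltn_predL p10 orbT.
- have := @mkseq_steps_cat F (fun j => j * p2 %/ q2) (fun j => j * p1 %/ q1) q2 q1 p2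
    q21 q11 F2 G2.
  rewrite [F q2]Fq2 [F (q2 - 1)]F2// [F (q2 + 1)]G2 ?q11// divn_slope_pred ?p20//.
  rewrite mul1n divn_small// addn0 eqxx [X in [:: X; _]]neq_ltn subn1 ltn_predL p20 orbT.
  by rewrite [q2 + q1]addnC.
Qed.

Lemma slope_inverse p q : slope p q ->
  exists j m, 0 < j < q /\ j * p = m * q + 1.
Proof.
move=> /and3P[p0 pq cpq]; have q1 : 1 < q by apply: leq_ltn_trans pq.
have q0 := ltnW q1.
have [a b Eab _] := @egcdnP p q p0; move: Eab; rewrite (eqP cpq) => Eab.
have E : a %% q * p %% q = 1 by rewrite modnMml Eab modnMDl modn_small.
exists (a %% q), (a %% q * p %/ q); split; last by rewrite {1}(divn_eq (_ * p) q) E.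
by rewrite ltn_pmod// andbT; case: posnP => // r0; move: E; rewrite r0 mul0n mod0n.
Qed.

(* With D = p1 q2 - p2 q1, the hypotheses say that j p mod q >= D for j < q2 and
   j p mod q < q - D for j < q1. If D > 1, the inverse j of p mod q thus satisfies
   j >= q2 and q - j >= q1, hence j = q2, but q2 p = D mod q. *)
Lemma mediant_det p q p1 q1 p2 q2 : slope p q -> p = p1 + p2 -> q = q1 + q2 ->
  0 < q1 -> 0 < q2 -> 0 < p1 ->
  let F j := j * p %/ q in
  F q1 = p1 - 1 -> F q2 = p2 ->
  (forall j, 0 < j < q2 -> F (q1 + j) = p1 + F j) ->
  (forall j, 0 < j < q1 -> F (q2 + j) = p2 + F j) ->
  p1 * q2 = (p2 * q1).+1.
Proof.
move=> sl Ep Eq q10 q20 p10 F Fq1 Fq2 G1 G2; have /and3P[p0 pq _] := sl.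
have q0 : 0 < q by lia.
have BF j : F j * q <= j * p < (F j).+1 * q by apply: divn_bounds.
have Funiq j k : k * q <= j * p < k.+1 * q -> F j = k by apply: divn_uniq.
move: F BF Funiq Fq1 Fq2 G1 G2 => /= F BF Funiq Fq1 Fq2 G1 G2.
have [D [D0 ED1]] : exists D, 0 < D /\ p1 * q = q1 * p + D.
  exists (p1 * q - q1 * p); have := BF q1; rewrite Fq1.
  by rewrite subn1 prednK//; lia.
have ED2 : q2 * p = p2 * q + D.
  by move: ED1; rewrite Ep Eq; lia.
have Dq : D < q by have := BF q2; rewrite Fq2 mulSn; lia.
suff D1 : D = 1 by move: ED1; rewrite D1 Ep Eq; lia.
have [j [m [jq Em]]] := slope_inverse sl.
have Fj : F j = m by apply: Funiq; rewrite mulSn; lia.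
have [lt|ge] := ltnP j q2.
  have := G1 j; rewrite Fj; have := BF (q1 + j) => B /(_ ltac:(lia)) E.
  by move: B; rewrite E mulnDl [(q1 + j) * p]mulnDl; lia.
have [jE|jN] := eqVneq j q2.
  have := Fq2; rewrite -jE Fj => mE; move: Em ED2; rewrite jE mE; lia.
have mp : m < p.
  have : m * q < p * q by rewrite -addn1 -Em mulnC leq_mul2l; lia.
  by rewrite ltn_pmul2r.
have [k Ek] : exists k, p = m + 1 + k by exists (p - m - 1); lia.
(* (q - j)p is -1 modulo q, the largest residue, so adding q2 p, which is D modulo q, passes a
   multiple of q, against [G2]. *)
have Eqj : (q - j) * p = k * q + (q - 1).
  have -> : (q - j) * p = q * p - j * p by rewrite mulnBl.
  have -> : q * p = m * q + q + k * q by rewrite {1}Ek; lia.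
  by lia.
have Fk : F (q - j) = k by apply: Funiq; rewrite Eqj mulSn; lia.
have := G2 (q - j); rewrite Fk; have := BF (q2 + (q - j)) => B /(_ ltac:(lia)) E.
by move: B; rewrite E [(q2 + _) * p]mulnDl ED2 Eqj mulSn mulnDl; lia.
Qed.

(** Behind v1 01 the word v continues with v2, which is also a prefix of v, and likewise with the
    roles exchanged; counting 1's in prefixes gives the hypotheses of [mediant_det]. *)
Lemma decomposition_det v v1 v2 : central v -> central_decomposition v v1 v2 ->
  (count_mem true v1 + 1) * (size v2 + 2) =
  ((count_mem true v2 + 1) * (size v1 + 2)).+1.
Proof.
move=> /central_slope[sl Ev] [/central_slope[s1 Ev1] /central_slope[s2 Ev2] E1 E2].
have szE : size v = size v1 + 2 + size v2 by rewrite E1 !size_cat /= addnA.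
have cE : count_mem true v = count_mem true v1 + count_mem true v2 + 1.
  by rewrite E1 !count_cat /=; lia.
have F n : n <= size v -> count_mem true (take n v) =
    n.+1 * (count_mem true v + 1) %/ (size v + 2).
  by move=> le; rewrite {1}Ev count_take_central//; lia.
have p12 n w w' (b : word) : v = w ++ b ++ w' -> size b = 2 -> n <= size w' ->
    count_mem true (take (size w + n.+2) v) =
    count_mem true w + count_mem true b + count_mem true (take n w').
  move=> -> sb le; rewrite catA take_cat size_cat sb ltnNge leq_add2l /=.
  by rewrite subnDl subSS subSS subn0 !count_cat.
have p1 w w' (b : bool) : v = w ++ [:: b] ++ w' ->
    count_mem true (take (size w).+1 v) = count_mem true w + b.
  by move=> ->; rewrite catA take_cat size_cat addn1 ltnn subnn take0 cats0 count_cat; case: b.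
have pre n w w' : v = w ++ w' -> n <= size w -> take n v = take n w.
  by move=> -> le; rewrite takel_cat.
apply: (mediant_det sl); try by clear -szE cE; lia.
- rewrite addn2 -F; last by clear -szE; lia.
  by rewrite (p1 v1 (true :: v2) false)//; lia.
- rewrite addn2 -F; last by clear -szE; lia.
  by rewrite (p1 v2 (false :: v1) true).
- case=> [//|j]; rewrite addn2 ltnS => /andP[_ jlt].
  have jle : j <= size v2 by [].
  have -> : size v1 + 2 + j.+1 = (size v1 + j.+2).+1 by clear; lia.
  rewrite -!F; [|by clear -szE jle; lia..].
  rewrite (p12 j v1 v2 [:: false; true])// (pre j v2 ([:: true; false] ++ v1))//=.
- case=> [//|j]; rewrite addn2 ltnS => /andP[_ jlt].
  have jle : j <= size v1 by [].
  have -> : size v2 + 2 + j.+1 = (size v2 + j.+2).+1 by clear; lia.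
  rewrite -!F; [|by clear -szE jle; lia..].
  by rewrite (p12 j v2 v1 [:: true; false])// (pre j v1 ([:: false; true] ++ v2))//=.
Qed.

Lemma decomposition_size v v1 v2 : central_decomposition v v1 v2 ->
  size v = size v1 + 2 + size v2.
Proof. by case=> _ _ -> _; rewrite !size_cat /= addnA. Qed.

Lemma decomposition_count v v1 v2 : central_decomposition v v1 v2 ->
  count_mem true v = count_mem true v1 + count_mem true v2 + 1.
Proof. by case=> _ _ -> _; rewrite !count_cat /=; lia. Qed.

Lemma decomposition_coprime v v1 v2 : central v -> central_decomposition v v1 v2 ->
  coprime (size v1 + 2) (size v2 + 2).
Proof.
move=> cv dec; have E := decomposition_det cv dec.
rewrite /coprime -dvdn1 -(@dvdn_addr ((count_mem true v2 + 1) * (size v1 + 2))).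
  by rewrite addn1 -E dvdn_mull// dvdn_gcdr.
by rewrite dvdn_mull// dvdn_gcdl.
Qed.

(** Both b and d are minus the inverse of p modulo q. *)
Lemma det_unique p q a b c d : coprime p q -> b < q -> d < q ->
  a * q = b * p + 1 -> c * q = d * p + 1 -> b = d.
Proof.
move=> cpq; wlog le : a b c d / d <= b.
  move=> W bq dq E1 E2; case: (leqP d b) => [|/ltnW] le; first exact: W E1 E2.
  by apply/esym; exact: W E2 E1.
move=> bq dq E1 E2.
have : q %| (b - d) * p.
  have -> : (b - d) * p = (a - c) * q by rewrite !mulnBl E1 E2 subnDr.
  by rewrite dvdn_mull.
rewrite Gauss_dvdl 1?coprime_sym//; case: (posnP (b - d)) => [|lt /dvdn_leq]; lia.
Qed.

Lemma decomposition_uniq v v1 v2 w1 w2 : central v ->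
  central_decomposition v v1 v2 -> central_decomposition v w1 w2 ->
  v1 = w1 /\ v2 = w2.
Proof.
move=> cv dv dw.
suff szE : size v1 = size w1.
  case: dv dw => _ _ + _ [_ _ + _] => -> /eqP.
  by rewrite eqseq_cat// => /andP[/eqP-> /eqP[->]].
have /and3P[p0 pq cpq] := (central_slope cv).1.
(* The determinant equation, rewritten with the slope of v, fixes |x1| + 2 modulo |v| + 2. *)
have key x1 x2 : central_decomposition v x1 x2 ->
    (count_mem true x1 + 1) * (size v + 2) =
    (size x1 + 2) * (count_mem true v + 1) + 1 /\ size x1 + 2 < size v + 2.
  move=> dx; have := decomposition_det cv dx; rewrite (decomposition_size dx).
  by rewrite (decomposition_count dx); lia.
have [E1 b1] := key _ _ dv; have [E2 b2] := key _ _ dw.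
by apply/eqP; rewrite -(eqn_add2r 2) (det_unique cpq b1 b2 E1 E2).
Qed.

(** Farey parents of p/q: q2 is the inverse of p modulo q, and p1/q1 is what remains. Both letters
    occur, so 1 < p < q - 1, which yields p2 > 0 and p1 < q1. *)
Lemma decomposition_exists v : central v -> false \in v -> true \in v ->
  exists v1 v2, central_decomposition v v1 v2.
Proof.
move=> [p [q [sl Ev]]] v0 v1; have /and3P[p0 pq cpq] := sl.
have szv : size v = q - 2 by rewrite Ev size_central_word.
have cv : count_mem true v = p - 1 by rewrite Ev count_central.
have c0 : 0 < count_mem false v by rewrite -has_count has_pred1.
have c1 : 0 < count_mem true v by rewrite -has_count has_pred1.
have c01 : count_mem false v + count_mem true v = size v.
  by rewrite -(count_predC (pred1 true)) addnC; congr (_ + _); apply: eq_count => -[].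
have p1 : 1 < p by lia.
have pq1 : p + 1 < q by lia.
have [q2 [p2 [/andP[q20 q2q] E]]] := slope_inverse sl.
have [q1 Eq1] : exists q1, q = q1 + q2 by exists (q - q2); lia.
have p2p : p2 < p.
  have : p2 * q < p * q by rewrite -addn1 -E mulnC leq_mul2l ltnW// orbT.
  by rewrite ltn_pmul2r//; lia.
have [p1' Ep1] : exists p1', p = p1' + p2 by exists (p - p2); lia.
have p20 : 0 < p2 by case: (posnP p2) E => // ->; lia.
have D : p1' * q2 = (p2 * q1).+1 by move: E; rewrite Ep1 Eq1; lia.
have pq2 : p2 < q2.
  rewrite -(@ltn_pmul2r q); last by lia.
  by move: E pq1 q20; clear; nia.
have pq1' : p1' < q1.
  have E1 : p1' * q = q1 * p + 1 by rewrite Ep1 Eq1; lia.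
  have q10 : 0 < q1 by lia.
  have : q1 * (p + 2) <= q1 * q by rewrite leq_mul2l; lia.
  by rewrite -(@ltn_pmul2r q) ?E1; lia.
have cop a b c d : a * b = (c * d).+1 -> coprime a d /\ coprime c b.
  move=> H; split; rewrite /coprime -dvdn1 -(@dvdn_addr (c * d)) ?addn1 -?H.
  - by rewrite dvdn_mulr// dvdn_gcdl.
  - by rewrite dvdn_mull// dvdn_gcdr.
  - by rewrite dvdn_mull// dvdn_gcdr.
  - by rewrite dvdn_mulr// dvdn_gcdl.
have [co1 co2] := cop _ _ _ _ D.
have s1 : slope p1' q1 by rewrite /slope pq1' co1; lia.
have s2 : slope p2 q2 by rewrite /slope pq2 co2 p20.
exists (central_word p1' q1), (central_word p2 q2).
have [M1 M2] := central_word_mediant s1 s2 D.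
by split; rewrite ?Ev ?Ep1 ?Eq1//; [exists p1', q1|exists p2, q2].
Qed.

(** Replacing one of v1, v2 by v preserves determinant 1, so the mediants of v with v2 and of v1
    with v give central words. *)
Lemma central_extend v v1 v2 : central v -> central_decomposition v v1 v2 ->
  [/\ central (v ++ [:: false; true] ++ v2),
      v ++ [:: false; true] ++ v2 = v2 ++ [:: true; false] ++ v,
      central (v ++ [:: true; false] ++ v1) &
      v ++ [:: true; false] ++ v1 = v1 ++ [:: false; true] ++ v].
Proof.
move=> cv dec; have D := decomposition_det cv dec.
have szE := decomposition_size dec; have cE := decomposition_count dec.
have [sl Ev] := central_slope cv.
have [c1 c2 E1 E2] := dec; have [s1 Ev1] := central_slope c1.
have [s2 Ev2] := central_slope c2.
have D2 : (count_mem true v + 1) * (size v2 + 2) =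
  ((count_mem true v2 + 1) * (size v + 2)).+1 by rewrite szE cE; lia.
have D1 : (count_mem true v1 + 1) * (size v + 2) =
  ((count_mem true v + 1) * (size v1 + 2)).+1 by rewrite szE cE; lia.
have [M1 M1'] := central_word_mediant s1 sl D1.
have [M2 M2'] := central_word_mediant sl s2 D2.
have /and3P[p0 pq _] := sl; have /and3P[p10 pq1 _] := s1.
have /and3P[p20 pq2 _] := s2.
rewrite -Ev -Ev1 in M1 M1'; rewrite -Ev -Ev2 in M2 M2'.
split; rewrite -?M1 -?M1' -?M2 -?M2'//.
  by eexists _, _; split; last by []; apply: slope_addn.
by eexists _, _; split; last by []; apply: slope_addn.
Qed.

Lemma decomposition_period v v1 v2 : central_decomposition v v1 v2 ->
  is_period (size v1 + 2) v /\ is_period (size v2 + 2) v.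
Proof.
move=> dec; have szE := decomposition_size dec; case: dec => _ _ E1 E2.
have nthE w w' (b : word) i : v = w ++ b ++ w' -> size b = 2 ->
    nth false v (i + (size w + 2)) = nth false w' i.
  move=> -> sb; rewrite catA nth_cat size_cat sb ltnNge leq_addl /=.
  by rewrite addnK.
have preE w w' i : v = w ++ w' -> i < size w -> nth false v i = nth false w i.
  by move=> -> lt; rewrite nth_cat lt.
split; split=> [|i lt]; try lia.
- by rewrite (nthE _ _ _ _ E1)// (preE _ _ _ E2)//; lia.
- by rewrite (nthE _ _ _ _ E2)// (preE _ _ _ E1)//; lia.
Qed.

(** * The central words 1^k and 0^k *)

Lemma nseq1_central_word k : central_word k.+1 k.+2 = nseq k true.
Proof.
apply: (@eq_from_nth _ false); rewrite size_central_word ?size_nseq ?subn2//= => i lt.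
rewrite nth_mkseq ?subn2// nth_nseq lt /mech_word.
by rewrite (@divn_uniq _ _ i.+1) ?(@divn_uniq _ _ i) ?neq_ltn ?leqnn ?orbT//; nia.
Qed.

Lemma nseq0_central_word k : central_word 1 k.+2 = nseq k false.
Proof.
apply: (@eq_from_nth _ false); rewrite size_central_word ?size_nseq ?subn2//= => i lt.
rewrite nth_mkseq ?subn2// nth_nseq lt /mech_word !muln1 !divn_small//; lia.
Qed.

Lemma slope_succ k : slope k.+1 k.+2.
Proof. by rewrite /slope !ltnS leqnn coprimenS. Qed.

Lemma slope_1 k : slope 1 k.+2.
Proof. by rewrite /slope coprime1n. Qed.

Lemma central_nseq k b : central (nseq k b).
Proof.
case: b; rewrite -?nseq1_central_word -?nseq0_central_word.
  by exists k.+1, k.+2; split=> //; exact: slope_succ.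
by exists 1, k.+2; split=> //; exact: slope_1.
Qed.

(** A mediant of two constant words of consecutive lengths, read as 1^(k+1) 01 1^k or 0^k 01
    0^(k+1). *)
Lemma central_nseq_cat k b : central (nseq k.+1 b ++ ~~ b :: nseq k.+1 b).
Proof.
case: b.
- have [] := @central_word_mediant k.+2 k.+3 k.+1 k.+2 (slope_succ _) (slope_succ _).
    by lia.
  rewrite !nseq1_central_word => E _; eexists _, _; split; last exact/esym/E.
  by apply: slope_addn; lia.
- have [] := @central_word_mediant 1 k.+2 1 k.+3 (slope_1 _) (slope_1 _); first by lia.
  rewrite !nseq0_central_word => E _; exists 2, (k.+2 + k.+3); split.
    by apply: (@slope_addn 1 k.+2 1 k.+3); lia.
  by rewrite E -(addn1 k) nseqD -!catA.
Qed.

(** * Sequences with arbitrarily long central prefixes *)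

Section SlopeLimit.
Import GRing.Theory Num.Theory.
Local Open Scope ring_scope.

(** Take a = sup U(n)/(n+1). A slope p/q good for both m and n separates U(m)/(m+1) from
    (U(n)+1)/(n+1), hence U(n) <= (n+1)a <= U(n)+1. *)
Lemma slope_limit (R : realType) (U : nat -> nat) :
  (forall N, exists p q, (0 < p < q)%N /\
    forall n, (n <= N)%N -> U n = (n.+1 * p %/ q)%N) ->
  exists2 a : R, 0 <= a <= 1 &
    (forall n, (U n)%:R <= n.+1%:R * a < (U n).+1%:R) \/
    (forall n, (U n)%:R < n.+1%:R * a <= (U n).+1%:R).
Proof.
move=> good.
have n0 n : 0 < n.+1%:R :> R by rewrite ltr0n.
have bnd p q n : (0 < p < q)%N -> U n = (n.+1 * p %/ q)%N ->
    (U n)%:R <= n.+1%:R * (p%:R / q%:R : R) < (U n).+1%:R.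
  move=> /andP[p0 pq] E; have q0 : (0 < q)%N by lia.
  have /andP[b1 b2] := divn_bounds (n.+1 * p) q0.
  rewrite mulrA ler_pdivlMr ?ltr0n// ltr_pdivrMr ?ltr0n//.
  by rewrite -!natrM ler_nat ltr_nat E b1 b2.
pose E := range (fun n => (U n)%:R / n.+1%:R : R)%classic.
have ub n : ubound E ((U n).+1%:R / n.+1%:R).
  move=> _ [m _ <-]; have [p [q [pq G]]] := good (maxn m n).
  have /andP[b1 _] := bnd _ _ _ pq (G m (leq_maxl _ _)).
  have /andP[_ b2] := bnd _ _ _ pq (G n (leq_maxr _ _)).
  apply: (@le_trans _ _ (p%:R / q%:R)).
    by rewrite ler_pdivrMr// mulrC.
  by rewrite ler_pdivlMr// mulrC ltW.
have E0 : (E !=set0)%classic by exists ((U 0)%:R / 1); exists 0%N.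
have hs : has_sup E by split=> //; eexists; exact: (ub 0%N).
have lo n : (U n)%:R <= n.+1%:R * sup E.
  rewrite mulrC -ler_pdivrMr//; apply: sup_upper_bound => //.
  by exists n.
have hi n : n.+1%:R * sup E <= (U n).+1%:R.
  by rewrite mulrC -ler_pdivlMr//; apply: ge_sup.
have U0 : U 0%N = 0%N.
  have [p [q [pq G]]] := good 0%N; rewrite G// mul1n divn_small//; lia.
exists (sup E).
  by have := lo 0%N; have := hi 0%N; rewrite U0 !mul1r => -> ->.
(* If good slopes at least [sup E] exist for every N, the upper bound is strict; otherwise from some
   N on all good slopes lie below it, and the lower bound is strict. *)
have [A|/existsNP[N nA]] := pselect (forall N, exists p q, [/\ (0 < p < q)%N,
    forall n, (n <= N)%N -> U n = (n.+1 * p %/ q)%N & sup E <= p%:R / q%:R]).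
  left=> n; rewrite lo /=; have [p [q [pq G le]]] := A n.
  have /andP[_ lt] := bnd _ _ _ pq (G n (leqnn n)).
  by apply: le_lt_trans lt; rewrite ler_pM2l.
right=> n; rewrite hi andbT; have [p [q [pq G]]] := good (maxn N n).
have /andP[le _] := bnd _ _ _ pq (G n (leq_maxr _ _)).
apply: le_lt_trans le _; rewrite ltr_pM2l// ltNge; apply/negP => sle.
apply: nA; exists p, q; split=> // m mN; apply: G.
by apply: leq_trans mN _; rewrite leq_maxl.
Qed.

Lemma rational_fraction (R : realType) (a : R) : 0 <= a -> ~ irrational a ->
  exists b c, [/\ (0 < c)%N, coprime b c & a = b%:R / c%:R].
Proof.
move=> a0 /contrapT[r _ ra]; exists `|numq r|%N, `|denq r|%N; split.
- by rewrite absz_gt0 denq_neq0.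
- exact: coprime_num_den.
- have r0 : 0 <= r by rewrite -(ler0q R) ra.
  by rewrite -ra /ratr !natr_absz !ger0_norm ?denq_ge0 ?numq_ge0.
Qed.

(** An irrational limit a gives a Sturmian sequence. For a = b/c the two alternatives of
    [slope_limit] give (w10)^oo and (w01)^oo, with the constant sequences at b = 0 and b = c. *)
Lemma central_limit (R : realType) (u : binseq) :
  (forall N, exists2 v, central_prefix u v & (N <= size v)%N) ->
  [\/ u = (fun=> false), u = (fun=> true), characteristic_sturmian R u |
      characteristic_periodic_balanced u].
Proof.
move=> long; have good N : exists p q, (0 < p < q)%N /\
    forall n, (n <= N)%N -> ones u n = (n.+1 * p %/ q)%N.
  have [v [[p [q [sl Ev]]] pre] Nv] := long N; exists p, q.
  have /and3P[p0 pq _] := sl; rewrite p0 pq; split=> // n nN.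
  have nv : (n <= size v)%N by apply: leq_trans nN Nv.
  rewrite -(count_take_central sl); last by rewrite -(size_central_word p q) -Ev.
  by rewrite -Ev pre /mkseq -map_take take_iota (minn_idPl nv).
have [a /andP[a0 a1] cases] := slope_limit R good.
have [irr|nirr] := pselect (irrational a).
  apply: Or43; exists a.
  have nint n (m : nat) : (n.+1%:R * a != m%:R).
    apply/eqP => E; apply: irr; exists (m%:Q / n.+1%:Q) => //=.
    by rewrite fmorph_div /= !ratr_int -!pmulrn -E mulrAC divff ?mul1r// pnatr_eq0.
  have b n : (ones u n)%:R <= n.+1%:R * a < (ones u n).+1%:R.
    case: cases => // /(_ n) /andP[l h]; rewrite ltW// lt_neqAle h andbT.
    exact: nint.
  have fl n : Num.floor (n.+1%:R * a) = ones u n.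
    by apply: floor_def; rewrite intrD -!pmulrn natr1 b.
  split=> //.
  - by rewrite lt_neqAle a0 andbT eq_sym; have := nint 0%N 0%N; rewrite mul1r.
  - by rewrite lt_neqAle a1 andbT; have := nint 0%N 1%N; rewrite mul1r.
  - by move=> n; rewrite !fl onesS PoszD addrC addKr.
have [b [c [c0 bc Ea]]] := rational_fraction a0 nirr.
have cR : 0 < c%:R :> R by rewrite ltr0n.
case: cases => B.
- have {}B n : ones u n = (n.+1 * b %/ c)%N.
    apply/esym/divn_uniq; have := B n; rewrite Ea mulrA ler_pdivlMr// ltr_pdivrMr//.
    by rewrite -!natrM ler_nat ltr_nat.
  have bltc : (b < c)%N.
    by rewrite ltnNge -(mul1n c) -leq_divRL// -(mul1n b) -B.
  have [b0|b0] := posnP b.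
    apply: Or41; apply: ones_inj => n; rewrite B b0 muln0 div0n.
    by elim: n => // n IH; rewrite onesS -IH.
  have sl : slope b c by rewrite /slope b0 bltc.
  apply: Or44; exists b, c; split=> //; left.
  rewrite -(shift1_scons false u) -[RHS](shift1_scons false) omega_10//; congr shift.
  by apply: ones_inj => -[//|n]; rewrite ones_scons B ones_mech.
- have {}B n : (ones u n * c < n.+1 * b <= (ones u n).+1 * c)%N.
    have := B n; rewrite Ea mulrA ltr_pdivlMr// ler_pdivrMr//.
    by rewrite -!natrM ler_nat ltr_nat.
  have := B 0%N; rewrite ones0 mul0n !mul1n => /andP[b0 lebc].
  have [bE|bN] := eqVneq b c.
    apply: Or42; apply: ones_inj => n.
    have -> : ones (fun=> true) n = n by elim: n => // n IH; rewrite onesS IH addn1.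
    have := B n; rewrite bE ltn_pmul2r// leq_pmul2r// ltnS => /andP[l1 l2].
    by apply/eqP; rewrite eqn_leq l1 -ltnS.
  have sl : slope b c by rewrite /slope b0 ltn_neqAle bN lebc.
  apply: Or44; exists b, c; split=> //; right.
  rewrite -(shift1_scons false u) -[RHS](shift1_scons false); congr shift.
  apply: ones_inj => -[//|n]; rewrite ones_omega_01// ones_scons.
  by apply/esym/divn_uniq; have := B n; case: (n.+1 * b)%N.
Qed.

End SlopeLimit.

Lemma longest_central_prefix_exists (u : binseq) N :
  (forall v, central_prefix u v -> size v < N) ->
  exists v, longest_central_prefix u v.
Proof.
move=> bound.
pose P n := `[< exists2 v, central_prefix u v & size v = n >].
have ex : exists n, P n.
  exists 0; apply/asboolP; exists [::] => //; split=> //.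
  exact: (central_nseq 0 true).
have ub n : P n -> n <= N by move=> /asboolP[v /bound lt <-]; exact: ltnW.
case: (ex_maxnP ex ub) => n /asboolP[v pv sv] max; exists v; split=> // v' pv'.
by rewrite sv; apply: max; apply/asboolP; exists v'.
Qed.

(** * Comparing prefixes *)

Definition starts (x : binseq) (w : word) : Prop := w = mkseq x (size w).

Lemma startsP x w :
  starts x w <-> forall i, i < size w -> x i = nth false w i.
Proof.
split=> [E i lt|E]; first by rewrite E nth_mkseq.
by apply: (@eq_from_nth _ false); rewrite ?size_mkseq// => i lt; rewrite nth_mkseq ?E.
Qed.

Lemma starts_catl x a b : starts x (a ++ b) -> starts x a.
Proof.
move=> /startsP E; apply/startsP => i lt; rewrite E ?nth_cat ?lt//.
by rewrite size_cat ltn_addr.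
Qed.

Lemma starts_le (x y : binseq) c s t :
  starts x (c ++ false :: s) -> starts y (c ++ true :: t) -> (x <= y)%O.
Proof.
move=> /startsP X /startsP Y; apply/lexP; right; exists (size c); split=> [i lt||].
- by rewrite X ?Y ?size_cat ?ltn_addr// !nth_cat lt.
- by rewrite X ?nth_cat ?ltnn ?subnn// size_cat /= addnS ltnS leq_addr.
- by rewrite Y ?nth_cat ?ltnn ?subnn// size_cat /= addnS ltnS leq_addr.
Qed.

(** The two factorisations say that t begins with a and repeats itself after |a| letters. *)
Lemma starts_omega a t t' t'' : 0 < size a -> t = a ++ t' -> t = t' ++ t'' ->
  starts (omega a) t.
Proof.
move=> a0 E1 E2; apply/startsP; elim/ltn_ind => i IH lt.
have [ia|ai] := ltnP i (size a).
  by rewrite /omega modn_small// E1 nth_cat ia.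
have lt' : i - size a < size t' by move: lt; rewrite {1}E1 size_cat; lia.
have -> : omega a i = omega a (i - size a) by rewrite -{1}(subnK ai) /omega modnDr.
rewrite IH; [|lia|lia].
by rewrite E1 [RHS]nth_cat ltnNge ai /= -E1 E2 nth_cat lt'.
Qed.

Lemma starts_omega1 a : 0 < size a -> starts (omega a) a.
Proof. by move=> a0; apply: (@starts_omega a a [::] a); rewrite ?cats0. Qed.

Lemma starts_omega2 a : 0 < size a -> starts (omega a) (a ++ a).
Proof. by move=> a0; apply: (@starts_omega a (a ++ a) a a). Qed.

Lemma word_lt_split s t : size s = size t -> word_lt s t ->
  exists c s' t', s = c ++ false :: s' /\ t = c ++ true :: t'.
Proof.
rewrite /word_lt; elim: s t => [|x s IH] [|y t]//= [sz].
rewrite ltxi_cons => /andP[le /implyP lt]; move: le lt.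
case: x; case: y => //= _.
- by move=> /(_ isT) /(IH _ sz) [c [s' [t' [-> ->]]]]; exists (true :: c), s', t'.
- by move=> _; exists [::], s, t.
- by move=> /(_ isT) /(IH _ sz) [c [s' [t' [-> ->]]]]; exists (false :: c), s', t'.
Qed.

(** * Locating u in a plateau by its longest central prefix *)

Lemma phi_central v (u : binseq) : central v ->
  (omega (v ++ [:: false; true]) <= u)%O ->
  (u <= omega (v ++ [:: true; false]))%O ->
  phi (scons false u) = omega (true :: v ++ [:: false]).
Proof. by move=> [p [q [sl ->]]]; exact: phi_plateau. Qed.

(* Otherwise c starts with w and u has the longer central prefix v ++ b ++ w. *)
Lemma longest_split u v w b c s : longest_central_prefix u v ->
  central (v ++ b ++ w) -> b <> [::] ->
  (exists s', c ++ s = w ++ s') -> starts u (v ++ b ++ c) ->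
  exists2 d, w = c ++ d & 0 < size d.
Proof.
move=> [_ max] cw b0 [s' E] st.
have [lt|le] := ltnP (size c) (size w).
  exists (drop (size c) w); last by rewrite size_drop; lia.
  rewrite -{1}(cat_take_drop (size c) w); congr (_ ++ _).
  by have := congr1 (take (size c)) E; rewrite take_size_cat// takel_cat// ltnW.
have Ec : c = w ++ drop (size w) c.
  rewrite -{1}(cat_take_drop (size w) c); congr (_ ++ _).
  by have := congr1 (take (size w)) E; rewrite takel_cat// take_size_cat.
have := max (v ++ b ++ w); rewrite !size_cat; case: b b0 cw st => // x b _ cw st.
suff : central_prefix u (v ++ (x :: b) ++ w) by move=> pf /(_ pf) /=; lia.
split=> //; apply: (@starts_catl _ _ (drop (size w) c)).
by rewrite -!catA -Ec.
Qed.

(** Let c be the complement of b. Inside b^(k+1) c b^(k+1) such a difference can only sit at c, and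
    then u starts with b^(k+2); if it comes later, u starts with the whole word. Either way u has a
    longer central prefix. *)
Lemma longest_nseq_diff u b k n : longest_central_prefix u (nseq k.+1 b) ->
  let W := nseq k.+1 b ++ [:: ~~ b] in
  (forall i, i < n -> u i = omega W i) -> u n = b -> omega W n = ~~ b -> False.
Proof.
move=> [[_ pre] max] W E un Wn; have /startsP st : starts u (nseq k.+1 b) := pre.
have sW : starts (omega W) (nseq k.+1 b ++ ~~ b :: nseq k.+1 b).
  apply: (starts_catl (b := [:: ~~ b])); rewrite (_ : _ ++ _ = W ++ W).
    by apply: starts_omega2; rewrite size_cat addn1.
  by rewrite /W -!catA.
have [nk|nk] := ltnP n (2 * k + 3).
  have /startsP := sW; move=> /(_ n); rewrite size_cat [size (_ :: _)]/= !size_nseq Wn.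
  rewrite nth_cat size_nseq.
  move=> /(_ ltac:(lia)); case: ltnP => [lt|le].
    by rewrite nth_nseq lt; case: (b).
  case: (n - k.+1) (subnKC le) => [|m] Em.
    rewrite addn0 in Em; subst n => _; have := max (nseq k.+2 b).
    suff : central_prefix u (nseq k.+2 b).
      by move=> pf /(_ pf); rewrite !size_nseq ltnn.
    split; first exact: central_nseq.
    rewrite -/(starts _ _); apply/startsP => i; rewrite size_nseq nth_nseq => lt.
    rewrite lt; move: lt; rewrite ltnS leq_eqVlt => /predU1P[->//|lt].
    by rewrite st ?size_nseq// nth_nseq lt.
  rewrite -[~~ b :: _]cat1s nth_cat /= subSS subn0.
  rewrite -[b :: nseq k b]/(nseq k.+1 b) nth_nseq.
  by case: ltnP => [_|]; [case: (b)|lia].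
have := max (nseq k.+1 b ++ ~~ b :: nseq k.+1 b).
suff : central_prefix u (nseq k.+1 b ++ ~~ b :: nseq k.+1 b).
  by move=> pf /(_ pf); rewrite size_cat /= !size_nseq; lia.
split; first exact: (central_nseq_cat k b).
rewrite -/(starts _ _); apply/startsP => i lt; rewrite E.
  by move/startsP: sW; exact.
by move: lt; rewrite size_cat /= !size_nseq; lia.
Qed.

Lemma nseq_catC k (b : bool) s : nseq k b ++ b :: s = nseq k.+1 b ++ s.
Proof. by elim: k => //= k ->. Qed.

(** The plateau is that of 1^k, one letter shorter than the prefix: the letter after 1^k decides the
    lower bound, and [longest_nseq_diff] gives the upper bound (1^k 10)^oo. *)
Lemma phi_nseq1 u k : longest_central_prefix u (nseq k.+1 true) ->
  phi (scons false u) = omega (nseq k.+1 true ++ [:: false]).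
Proof.
move=> lg; have [[_ pre] max] := lg.
rewrite -[nseq k.+1 true]/(true :: nseq k true); apply: phi_central.
- exact: central_nseq.
- apply: (@starts_le _ _ (nseq k true) [:: true] [::]).
    by apply: starts_omega1; rewrite size_cat addn2.
  by rewrite nseq_catC cats0.
rewrite nseq_catC leNgt; apply/negP; rewrite lt_neqAle => /andP[/eqP ne /lexP[/ne//|]].
move=> [n [E Wn un]]; apply: (longest_nseq_diff lg _ un Wn) => i lt.
by rewrite E.
Qed.

(** The plateau of 0^k, with the arguments for the two bounds exchanged. *)
Lemma phi_nseq0 u k : longest_central_prefix u (nseq k.+1 false) ->
  phi (scons false u) = omega (true :: nseq k.+1 false).
Proof.
move=> lg; have [[_ pre] max] := lg.
rewrite -[nseq k.+1 false]cats0 -nseq_catC; apply: phi_central.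
- exact: central_nseq.
- rewrite nseq_catC leNgt; apply/negP; rewrite lt_neqAle => /andP[/eqP ne /lexP[/ne//|]].
  by move=> [n [E un Wn]]; apply: (longest_nseq_diff lg E un Wn).
apply: (@starts_le _ _ (nseq k false) [::] [:: false]).
  by rewrite nseq_catC cats0.
by apply: starts_omega1; rewrite size_cat addn2.
Qed.

(** Of the bounds (v01)^oo and (v10)^oo, one is decided by x alone, the other by comparing z with
    the second copy of v01 or v10. *)
Lemma phi_mixed_a u v x y z : longest_central_prefix u v ->
  starts u (v ++ [:: x; y] ++ z) -> size z = size v + 2 ->
  ([:: x; y] = [:: false; true] /\ word_lt (v ++ [:: false; true]) z) \/
  ([:: x; y] = [:: true; false] /\ word_lt z (v ++ [:: true; false])) ->
  phi (scons false u) = omega (true :: v ++ [:: false]).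
Proof.
move=> lg uE sz; have cv : central v := lg.1.1.
have szv a b : size (v ++ [:: a; b]) = size z by rewrite sz size_cat.
have pos a b : 0 < size (v ++ [:: a; b]) by rewrite size_cat addn2.
case=> -[[xE yE] lt]; move: uE; rewrite xE yE => st; apply: phi_central => //.
- have [c [s [t [E1 E2]]]] := word_lt_split (szv _ _) lt.
  apply: (@starts_le _ _ ((v ++ [:: false; true]) ++ c) s t).
    by rewrite -catA -E1; exact: starts_omega2.
  by rewrite -!catA -E2.
- apply: (@starts_le _ _ v (true :: z) [:: false]) => //.
  exact: starts_omega1.
- apply: (@starts_le _ _ v [:: true] (false :: z)) => //.
  exact: starts_omega1.
- have [c [s [t [E1 E2]]]] := word_lt_split (esym (szv _ _)) lt.
  apply: (@starts_le _ _ ((v ++ [:: true; false]) ++ c) s t).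
    by rewrite -!catA -E1.
  by rewrite -catA -E2; exact: starts_omega2.
Qed.

(** The plateau is that of v2: the prefix v2 10 of v puts u above (v2 01)^oo, and (v2 10)^oo begins
    with v 01 v2, which u leaves downwards because v is longest. *)
Lemma phi_mixed_b u v v1 v2 x y z : longest_central_prefix u v ->
  central_decomposition v v1 v2 ->
  starts u (v ++ [:: x; y] ++ z) -> size z = size v + 2 ->
  ([:: x; y] = [:: false; true] /\ word_lt z (v ++ [:: false; true])) \/
  [:: x; y] = [:: false; false] ->
  phi (scons false u) = omega (true :: v2 ++ [:: false]).
Proof.
move=> lg dec uE sz; have cv : central v := lg.1.1; have [_ cv2 E1 E2] := dec.
have [cw wE _ _] := central_extend cv dec.
have pos a b : 0 < size (v2 ++ [:: a; b]) by rewrite size_cat addn2.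
have stw : starts (omega (v2 ++ [:: true; false])) (v ++ [:: false; true] ++ v2).
  by apply: (@starts_omega _ _ v ([:: false; true] ++ v2)); rewrite // wE catA.
have lo : (omega (v2 ++ [:: false; true]) <= u)%O.
  apply: (@starts_le _ _ v2 [:: true] (false :: v1)); first exact: starts_omega1.
  by move: uE => /starts_catl; rewrite {1}E2.
case=> [[[xE yE] lt]|[xE yE]]; move: uE; rewrite xE yE => st; apply: phi_central => //.
- have [|c [s [t [Ez Ev]]]] := word_lt_split _ lt; first by rewrite sz size_cat.
  have [] := @longest_split u v v2 [:: false; true] c (true :: t) lg cw _ _ _ => //.
  + by exists ([:: true; false] ++ v1 ++ [:: false; true]); rewrite -Ev {1}E2 -!catA.
  + by apply: (@starts_catl _ _ (false :: s)); rewrite -!catA -Ez.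
  move=> d Ed d0.
  (* The word v01 also starts with v2, so its letter 1 at the first difference with z is the letter
     of v2 there. *)
  have [d' Ed'] : exists d', d = true :: d'.
    have : c ++ true :: t = c ++ d ++ [:: true; false] ++ v1 ++ [:: false; true].
      by rewrite catA -Ed -Ev {1}E2 -!catA.
    move/eqP; rewrite eqseq_cat// eqxx /= => /eqP.
    by case: (d) d0 => // a d' _ [-> _]; exists d'.
  apply: (@starts_le _ _ (v ++ [:: false; true] ++ c) s d').
    by rewrite -!catA -Ez.
  by rewrite -!catA -Ed' -Ed.
- apply: (@starts_le _ _ (v ++ [:: false]) z v2); by rewrite -!catA.
Qed.

(** Mirror image: v1 01 puts u below (v1 10)^oo, and (v1 01)^oo begins with v 10 v1, which u leaves
    upwards. *)
Lemma phi_mixed_c u v v1 v2 x y z : longest_central_prefix u v ->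
  central_decomposition v v1 v2 ->
  starts u (v ++ [:: x; y] ++ z) -> size z = size v + 2 ->
  ([:: x; y] = [:: true; false] /\ word_lt (v ++ [:: true; false]) z) \/
  [:: x; y] = [:: true; true] ->
  phi (scons false u) = omega (true :: v1 ++ [:: false]).
Proof.
move=> lg dec uE sz; have cv : central v := lg.1.1; have [cv1 _ E1 E2] := dec.
have [_ _ cw wE] := central_extend cv dec.
have pos a b : 0 < size (v1 ++ [:: a; b]) by rewrite size_cat addn2.
have stw : starts (omega (v1 ++ [:: false; true])) (v ++ [:: true; false] ++ v1).
  by apply: (@starts_omega _ _ v ([:: true; false] ++ v1)); rewrite // wE catA.
have hi : (u <= omega (v1 ++ [:: true; false]))%O.
  apply: (@starts_le _ _ v1 (true :: v2) [:: false]); last exact: starts_omega1.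
  by move: uE => /starts_catl; rewrite {1}E1.
case=> [[[xE yE] lt]|[xE yE]]; move: uE; rewrite xE yE => st; apply: phi_central => //.
- have [|c [s [t [Ev Ez]]]] := word_lt_split _ lt; first by rewrite sz size_cat.
  have [] := @longest_split u v v1 [:: true; false] c (false :: s) lg cw _ _ _ => //.
  + by exists ([:: false; true] ++ v2 ++ [:: true; false]); rewrite -Ev {1}E1 -!catA.
  + by apply: (@starts_catl _ _ (true :: t)); rewrite -!catA -Ez.
  move=> d Ed d0.
  have [d' Ed'] : exists d', d = false :: d'.
    have : c ++ false :: s = c ++ d ++ [:: false; true] ++ v2 ++ [:: true; false].
      by rewrite catA -Ed -Ev {1}E1 -!catA.
    move/eqP; rewrite eqseq_cat// eqxx /= => /eqP.
    by case: (d) d0 => // a d' _ [-> _]; exists d'.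
  apply: (@starts_le _ _ (v ++ [:: true; false] ++ c) d' t).
    by rewrite -!catA -Ed' -Ed.
  by rewrite -!catA -Ez.
- apply: (@starts_le _ _ (v ++ [:: true]) v1 z); by rewrite -!catA.
Qed.

(** * Existence of the longest central prefix and the value of [phi] in each case *)

Theorem theorem6p1 (R : realType) (u : binseq)
    (u_neq0 : u <> (fun=> false)) (u_neq1 : u <> (fun=> true))
    (u_not_sturmian : ~ characteristic_sturmian R u)
    (u_not_periodic : ~ characteristic_periodic_balanced u) :
  (exists v : word, longest_central_prefix u v) /\
  forall v : word, longest_central_prefix u v ->
  [/\ v <> [::],
      (* (i) *)
      forall k : nat, 1 <= k -> v = nseq k true ->
        [/\ slope k k.+1,
            phi (scons false u) = omega (nseq k true ++ [:: false]) &
            omega (nseq k true ++ [:: false]) =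
              omega (true :: central_word k k.+1 ++ [:: false])],
      (* (ii) *)
      forall k : nat, 1 <= k -> v = nseq k false ->
        [/\ slope 1 k.+1,
            phi (scons false u) = omega (true :: nseq k false) &
            omega (true :: nseq k false) =
              omega (true :: central_word 1 k.+1 ++ [:: false])] &
      (* (iii) *)
      false \in v -> true \in v ->
      (exists! v12 : word * word, central_decomposition v v12.1 v12.2) /\
      forall v1 v2 : word, central_decomposition v v1 v2 ->
      forall l1 l2 : nat, l1 = size v1 + 2 -> l2 = size v2 + 2 ->
      [/\ coprime l1 l2, is_period l1 v, is_period l2 v &
      forall (x y : bool) (z : word),
        mkseq u (2 * size v + 4) = v ++ [:: x; y] ++ z ->
        size z = size v + 2 ->
        [/\ (* (a) *)
            ([:: x; y] = [:: false; true] /\ word_lt (v ++ [:: false; true]) z)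
            \/ ([:: x; y] = [:: true; false] /\
                word_lt z (v ++ [:: true; false])) ->
            forall p q : nat, p = count_mem true v + 1 -> q = size v + 2 ->
            [/\ q = l1 + l2, slope p q,
                phi (scons false u) = omega (true :: v ++ [:: false]) &
                omega (true :: v ++ [:: false]) =
                  omega (true :: central_word p q ++ [:: false])],
            (* (b) *)
            ([:: x; y] = [:: false; true] /\ word_lt z (v ++ [:: false; true]))
            \/ [:: x; y] = [:: false; false] ->
            forall p q : nat, p = count_mem true v2 + 1 -> q = l2 ->
            [/\ slope p q,
                phi (scons false u) = omega (true :: v2 ++ [:: false]) &
                omega (true :: v2 ++ [:: false]) =
                  omega (true :: central_word p q ++ [:: false])] &
            (* (c) *)
            ([:: x; y] = [:: true; false] /\ word_lt (v ++ [:: true; false]) z)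
            \/ [:: x; y] = [:: true; true] ->
            forall p q : nat, p = count_mem true v1 + 1 -> q = l1 ->
            [/\ slope p q,
                phi (scons false u) = omega (true :: v1 ++ [:: false]) &
                omega (true :: v1 ++ [:: false]) =
                  omega (true :: central_word p q ++ [:: false])]]]].
Proof.
have omegaE v p q : central v -> p = count_mem true v + 1 -> q = size v + 2 ->
    slope p q /\ omega (true :: v ++ [:: false]) =
                 omega (true :: central_word p q ++ [:: false]).
  by move=> /central_slope[sl E] -> ->; rewrite -E.
split.
  (* Unbounded central prefixes would make u one of the sequences that the four hypotheses
     exclude. *)
  have [[N bound]|nb] := pselect (exists N, forall v, central_prefix u v -> size v < N).
    exact: longest_central_prefix_exists bound.
  have [N|//|//|//|//] := @central_limit R u.
  apply: contrapT => none; apply: nb; exists N => v pv.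
  by rewrite ltnNge; apply/negP => le; apply: none; exists v.
move=> v lg; have cv : central v := lg.1.1.
split.
(* The first letter of u alone is already a central prefix. *)
- move=> v0; have : central_prefix u (nseq 1 (u 0)) by split; first exact: central_nseq.
  by move=> /lg.2; rewrite v0.
- move=> [//|k] _ vE; rewrite vE in lg; split; first exact: slope_succ.
    exact: phi_nseq1.
  by rewrite nseq1_central_word.
- move=> [//|k] _ vE; rewrite vE in lg; split; first exact: slope_1.
    exact: phi_nseq0.
  by rewrite nseq0_central_word nseq_catC cats0.
move=> v0 v1; split.
  have [w1 [w2 dec]] := decomposition_exists cv v0 v1.
  exists (w1, w2); split=> // -[w1' w2'] dec'.
  by have [-> ->] := decomposition_uniq cv dec dec'.
move=> {v0 v1} v1 v2 dec l1 l2 -> ->; have [c1 c2 _ _] := dec.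
have [per1 per2] := decomposition_period dec.
split=> //; first exact: decomposition_coprime dec.
move=> x y z uE sz.
have st : starts u (v ++ [:: x; y] ++ z).
  rewrite /starts !size_cat sz -uE; congr mkseq; rewrite /=; lia.
split=> H p q pE qE.
- have [sl oE] := omegaE v p q cv pE qE; split=> //; last exact: (phi_mixed_a lg st sz H).
  by rewrite qE (decomposition_size dec); lia.
- by have [sl oE] := omegaE v2 p q c2 pE qE; split=> //; exact: (phi_mixed_b lg dec st sz H).
- by have [sl oE] := omegaE v1 p q c1 pE qE; split=> //; exact: (phi_mixed_c lg dec st sz H).
Qed.
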